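(* Let $G$ be a group. If the proper power graph $P^*(G)$ is connected, then $G$ is torsion-free or periodic.
   Context: The power graph $P(G)$ of a group $G$ is the undirected graph with vertex set $G$ in which two distinct elements are adjacent if and only if one of them is a positive power of the other; the proper power graph $P^*(G)$ is its induced subgraph on $G\setminus\{1\}$. A group is periodic if every element has finite order, and torsion-free if every non-identity element has infinite order. *)

(* Defs.v *)
From Stdlib Require Import Relation_Operators.
From mathcomp Require Import all_boot.

Set Implicit Arguments.
Unset Strict Implicit.
Unset Printing Implicit Defensive.

Local Open Scope group_scope.

Record sgraph := SGraph {
  vertex : Type;
  adj : vertex -> vertex -> Prop;
  adj_sym : forall x y, adj x y -> adj y x;
  adj_irrefl : forall x, ~ adj x x
}.

Section Induced.
Variables (Gamma : sgraph) (S : vertex Gamma -> Prop).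

Definition induced_adj (x y : {v | S v}) : Prop := adj (sval x) (sval y).

Lemma induced_adj_sym x y : induced_adj x y -> induced_adj y x.
Proof. exact: adj_sym. Qed.

Lemma induced_adj_irrefl x : ~ induced_adj x x.
Proof. exact: adj_irrefl. Qed.

Definition induced_subgraph : sgraph :=
  SGraph induced_adj_sym induced_adj_irrefl.

End Induced.

(* The graph without vertices counts as connected. *)
Definition connected (Gamma : sgraph) : Prop :=
  forall x y : vertex Gamma, clos_refl_trans (vertex Gamma) (@adj Gamma) x y.

Section PowerGraph.
Variable G : groupType.

Definition positive_power (y x : G) : Prop := exists2 n : nat, 0 < n & y = x ^+ n.

Definition power_adj (x y : G) : Prop :=
  x <> y /\ (positive_power x y \/ positive_power y x).

Lemma power_adj_sym x y : power_adj x y -> power_adj y x.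
Proof. by move=> [ne [xy|yx]]; split; [move/esym | right | move/esym | left]. Qed.

Lemma power_adj_irrefl x : ~ power_adj x x.
Proof. by case. Qed.

Definition power_graph : sgraph := SGraph power_adj_sym power_adj_irrefl.

Definition proper_power_graph : sgraph :=
  @induced_subgraph power_graph (fun x : G => x <> 1).

Definition finite_order (x : G) : Prop := exists2 n : nat, 0 < n & x ^+ n = 1.

Definition periodic : Prop := forall x : G, finite_order x.

Definition torsion_free : Prop := forall x : G, x <> 1 -> ~ finite_order x.

End PowerGraph.

(* Main.v *)
Require Import Defs.
From Stdlib Require Import Classical Relation_Operators.
From mathcomp Require Import all_boot.

(** An element and a positive power of it have finite order simultaneously, so
having finite order is constant along the edges of the power graph, hence on
the connected components of the proper power graph. When that graph is
connected, a single non-identity element of finite order therefore forces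
every element to have finite order. *)

Local Open Scope group_scope.

Lemma finite_order1 (G : groupType) : finite_order (1 : G).
Proof. by exists 1%N. Qed.

(** If [x ^+ k = 1] then [(x ^+ n) ^+ k = 1]; conversely [(x ^+ n) ^+ k = 1]
says [x ^+ (n * k) = 1], where positivity of [n] keeps the exponent
positive. *)
Lemma finite_order_positive_power (G : groupType) (x y : G) :
  positive_power y x -> finite_order y <-> finite_order x.
Proof.
case=> n n_gt0 ->; split=> [] [k k_gt0 xk1].
  by exists (n * k)%N; rewrite ?muln_gt0 ?n_gt0 // expgnA.
by exists k => //; rewrite -expgnA mulnC expgnA xk1 expg1n.
Qed.

Lemma finite_order_adj (G : groupType) (x y : G) :
  power_adj x y -> finite_order x <-> finite_order y.
Proof.
case=> _ [xy|yx]; first exact: finite_order_positive_power.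
by apply: iff_sym; exact: finite_order_positive_power.
Qed.

Lemma finite_order_path (G : groupType) (u v : vertex (proper_power_graph G)) :
  clos_refl_trans _ (@adj (proper_power_graph G)) u v ->
  finite_order (sval u) <-> finite_order (sval v).
Proof.
elim=> [a b /finite_order_adj //|//|a b c _ ab _ bc].
exact: iff_trans ab bc.
Qed.

Theorem lemma7 (G : groupType) :
  connected (proper_power_graph G) -> torsion_free G \/ periodic G.
Proof.
move=> connG; have [|some_torsion] := classic (torsion_free G); first by left.
right=> y; apply: NNPP => y_inf; apply: some_torsion => x x_neq1 x_fin.
have y_neq1 : y <> 1 by move=> y1; apply: y_inf; rewrite y1; exact: finite_order1.
have /finite_order_path xy := connG (exist _ x x_neq1) (exist _ y y_neq1).
by apply: y_inf; apply xy.
Qed.
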